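(* Let $q\in(0,1)$ be fixed. Then for every $x\in(0,1)$, $$\frac{1}{\sqrt{\pi_q}} \;<\; \frac{\Gamma_{q}(x+1)}{\Gamma_{q}\left(x+\frac{1}{2}\right)} \;<\; \left(1+\sqrt{q}\right)\cdot\frac{1}{\sqrt{\pi_q}},$$ where $\sqrt{\pi_q}=\Gamma_q\left(\frac12\right)$.
   Context: The $q$-deformed Gamma function is defined for $q\in(0,1)$ and $x>0$ by $$\Gamma_q(x)=(1-q)^{1-x}\prod_{n=0}^{\infty}\frac{1-q^{n+1}}{1-q^{n+x}},$$ equivalently by the Jackson integral $\Gamma_q(x)=\int_0^{1/(1-q)} t^{x-1}E_q^{-qt}\,d_qt$, where $\int_0^a f(t)\,d_qt=(1-q)a\sum_{n=0}^\infty f(aq^n)q^n$ and $E_q^{t}=\prod_{i=0}^{\infty}(1+(1-q)tq^i)$. The $q$-analogue $\pi_q$ of $\pi$ is the positive number determined by $\Gamma_q\left(\frac12\right)=\sqrt{\pi_q}$, i.e. $\pi_q=\Gamma_q\left(\frac12\right)^2$. *)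

(* Defs.v *)
From HB Require Import structures.
From mathcomp Require Import all_boot all_order all_algebra.
From mathcomp Require Import all_classical all_reals all_analysis.
Set Implicit Arguments.
Unset Strict Implicit.
Unset Printing Implicit Defensive.
Import Order.TTheory GRing.Theory Num.Theory.
Import numFieldNormedType.Exports.
Local Open Scope classical_set_scope.
Local Open Scope ring_scope.

(* The q-deformed Gamma function, meant for 0 < q < 1 and 0 < x, where the
   partial products converge; other arguments give unspecified values. *)
Definition qGamma (R : realType) (q x : R) : R :=
  (1 - q) `^ (1 - x) *
  limn (fun N : nat =>
    \prod_(0 <= n < N) ((1 - q ^+ n.+1) / (1 - q `^ (n%:R + x)))).

Definition qpi (R : realType) (q : R) : R := qGamma q (2^-1) ^+ 2.

(* Main.v *)
Require Import Defs.
From HB Require Import structures.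
From mathcomp Require Import all_boot all_order all_algebra.
From mathcomp Require Import all_classical all_reals all_analysis.
From mathcomp Require Import ring lra.
Set Implicit Arguments.
Unset Strict Implicit.
Unset Printing Implicit Defensive.
Import Order.TTheory GRing.Theory Num.Theory.
Import numFieldNormedType.Exports.
Local Open Scope classical_set_scope.
Local Open Scope ring_scope.

(* With s = sqrt q and (a; q) the infinite product of the 1 - a q^n, the middle
   quotient equals (1 - q)^(-1/2) (s u; q) / (q u; q) at u = q^x. The two bounds
   are its values at u = 1 and u = q, that is at x = 0 and x = 1, and it is
   strictly decreasing in u because each factor (1 - s t) / (1 - q t) is
   strictly decreasing in t. *)

Definition qPochhammer (R : realType) (a q : R) : R :=
  limn (fun N : nat => \prod_(0 <= n < N) (1 - a * q ^+ n)).

Lemma expr_bounds (R : realDomainType) (q : R) n :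
  0 < q < 1 -> 0 < q ^+ n <= 1.
Proof. by case/andP=> q0 q1; rewrite exprn_gt0 //= exprn_ile1 // ltW. Qed.

Lemma powR_lt1 (R : realType) (a r : R) : 0 <= a < 1 -> 0 < r -> a `^ r < 1.
Proof.
case/andP=> a0 a1 r0.
by rewrite -[ltRHS](congr1 (fun f => f r) (powR1 R)) gt0_ltr_powR ?nnegrE.
Qed.

Lemma qPochhammer_factor_gt0 (R : realType) (q a : R) (n : nat) :
  0 < q < 1 -> 0 <= a < 1 -> 0 < 1 - a * q ^+ n.
Proof. by move=> q01 a01; have := expr_bounds n q01; nra. Qed.

(* The exponent telescopes in N; the bound is 1 - y >= exp (- y / (1 - a)) for
   0 <= y <= a, multiplied over y = a q^n. *)
Lemma qPochhammer_partial_ge (R : realType) (q a : R) (N : nat) :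
  0 < q < 1 -> 0 <= a < 1 ->
  expR (- (a / ((1 - a) * (1 - q)) * (1 - q ^+ N))) <=
  \prod_(0 <= n < N) (1 - a * q ^+ n).
Proof.
move=> q01 a01; have a1 : 1 - a != 0 by rewrite gt_eqF //; lra.
have q1 : 1 - q != 0 by rewrite gt_eqF //; lra.
elim: N => [|N IH].
  by rewrite big_nil expr0 subrr mulr0 oppr0 expR0.
have -> : - (a / ((1 - a) * (1 - q)) * (1 - q ^+ N.+1)) =
    - (a / ((1 - a) * (1 - q)) * (1 - q ^+ N)) - a * q ^+ N / (1 - a).
  by rewrite exprS; field; rewrite a1 q1.
rewrite big_nat_recr //= expRD ler_pM ?expR_ge0 //.
have y_gt0 := qPochhammer_factor_gt0 N q01 a01.
(* After inversion, with [y = a * q ^+ N] and [z = y / (1 - a)], the factor bound reads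
   [(1 - y)^-1 <= expR z]. As [1 + z <= expR z], it suffices that [(1 - y) * (1 + z) - 1 = y * (a -
   y) / (1 - a)] is nonnegative. *)
rewrite expRN -[leRHS]invrK lef_pV2 ?posrE ?invr_gt0 ?expR_gt0 //.
apply: le_trans (expR_ge1Dx _).
rewrite -[leLHS]mul1r ler_pdivrMr //.
rewrite -subr_ge0 [X in 0 <= X](_ : _ =
  a * q ^+ N * (a * (1 - q ^+ N)) / (1 - a)); last by field.
have qN := expr_bounds N q01.
by rewrite divr_ge0 ?mulr_ge0 //; lra.
Qed.

Lemma is_cvg_qPochhammer (R : realType) (q a : R) : 0 < q < 1 -> 0 <= a < 1 ->
  cvgn (fun N : nat => \prod_(0 <= n < N) (1 - a * q ^+ n)).
Proof.
move=> q01 a01.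
have P_ge0 N : 0 <= \prod_(0 <= n < N) (1 - a * q ^+ n).
  by apply: prodr_ge0 => n _; exact/ltW/qPochhammer_factor_gt0.
apply: nonincreasing_is_cvgn; last by exists 0 => _ [N _ <-].
apply/nonincreasing_seqP => N; rewrite big_nat_recr //= ler_piMr //.
by have := expr_bounds N q01; nra.
Qed.

(** Positive factors alone only make the limit nonnegative; the exponential bound on the partial
    products, made uniform in [N] by dropping [q ^+ N], keeps it away from 0. *)
Lemma qPochhammer_gt0 (R : realType) (q a : R) :
  0 < q < 1 -> 0 <= a < 1 -> 0 < qPochhammer a q.
Proof.
move=> q01 a01; have c_ge0 : 0 <= a / ((1 - a) * (1 - q)).
  by rewrite divr_ge0 ?mulr_ge0 //; lra.
apply: (@lt_le_trans _ _ (expR (- (a / ((1 - a) * (1 - q)))))).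
  exact: expR_gt0.
apply: limr_ge; first exact: is_cvg_qPochhammer.
apply: nearW => N; apply: le_trans (qPochhammer_partial_ge N q01 a01).
by rewrite ler_expR lerN2 ler_piMr //; have := expr_bounds N q01; lra.
Qed.

(** Shifting the index does not change the limit, and the shifted partial product is [1 - a] times
    one based at [a * q]. *)
Lemma qPochhammerS (R : realType) (q a : R) : 0 < q < 1 -> 0 <= a < 1 ->
  qPochhammer a q = (1 - a) * qPochhammer (a * q) q.
Proof.
move=> q01 a01; have aq01 : 0 <= a * q < 1 by nra.
have shiftE : (fun N : nat => \prod_(0 <= n < N.+1) (1 - a * q ^+ n)) =
    (fun N => (1 - a) * \prod_(0 <= n < N) (1 - a * q * q ^+ n)).
  apply/funext => N; rewrite big_nat_recl // expr0 mulr1; congr (_ * _).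
  by apply: eq_bigr => n _; rewrite exprS mulrA.
apply: cvg_lim => //; rewrite -cvg_shiftS /= shiftE.
by apply: cvgMl_tmp; exact: is_cvg_qPochhammer.
Qed.

(** This is monotonicity in [u] of the quotient of the products at [a * u] and [b * u],
    cross-multiplied to avoid division. It holds factor by factor, the difference at [t = q ^+ n]
    being [(a - b) * (u - v) * t]; passing to the limit loses strictness. *)
Lemma le_qPochhammer_cross (R : realType) (q a b u v : R) :
  0 < q < 1 -> 0 < b < a -> 0 <= v < u -> a * u < 1 ->
  qPochhammer (a * u) q * qPochhammer (b * v) q <=
  qPochhammer (a * v) q * qPochhammer (b * u) q.
Proof.
move=> q01 ba vu au1.
have au : 0 <= a * u < 1 by nra.
have av : 0 <= a * v < 1 by nra.
have bu : 0 <= b * u < 1 by nra.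
have bv : 0 <= b * v < 1 by nra.
rewrite -!limM; try exact: is_cvg_qPochhammer.
apply: ler_lim; try by apply: is_cvgM; exact: is_cvg_qPochhammer.
apply: nearW => N /=; rewrite -!big_split /=.
apply: ler_prod => n _.
have := qPochhammer_factor_gt0 n q01 au.
have := qPochhammer_factor_gt0 n q01 bv.
have := expr_bounds n q01; move: (q ^+ n) => t t01 f1 f2.
apply/andP; split; first by rewrite mulr_ge0 ?ltW.
rewrite -subr_ge0 [X in 0 <= X](_ : _ =
  (a - b) * (u - v) * t); last by ring.
by rewrite !mulr_ge0 //; lra.
Qed.

(* Only the first factors need to be compared strictly: the remaining ones form
   the same products at [u q] and [v q]. *)
Lemma lt_qPochhammer_cross (R : realType) (q a b u v : R) :
  0 < q < 1 -> 0 < b < a -> 0 <= v < u -> a * u < 1 ->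
  qPochhammer (a * u) q * qPochhammer (b * v) q <
  qPochhammer (a * v) q * qPochhammer (b * u) q.
Proof.
move=> q01 ba vu au1.
have au : 0 <= a * u < 1 by nra.
have av : 0 <= a * v < 1 by nra.
have bu : 0 <= b * u < 1 by nra.
have bv : 0 <= b * v < 1 by nra.
have avq : 0 <= a * v * q < 1 by nra.
have buq : 0 <= b * u * q < 1 by nra.
have vuq : 0 <= v * q < u * q by nra.
have auq : a * (u * q) < 1 by nra.
have := le_qPochhammer_cross q01 ba vuq auq; rewrite !mulrA => le_tail.
rewrite (qPochhammerS q01 au) (qPochhammerS q01 av).
rewrite (qPochhammerS q01 bu) (qPochhammerS q01 bv).
rewrite [ltLHS]mulrACA [ltRHS]mulrACA.
apply: (@le_lt_trans _ _ ((1 - a * u) * (1 - b * v) *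
  (qPochhammer (a * v * q) q * qPochhammer (b * u * q) q))).
  by rewrite ler_wpM2l // mulr_ge0 //; lra.
rewrite ltr_pM2r ?mulr_gt0 ?qPochhammer_gt0 //.
by rewrite -subr_gt0 [X in 0 < X](_ : _ = (a - b) * (u - v)); [nra|ring].
Qed.

(** Since [q]^ (n + x) = q [^ x * q ^+ n], each partial product is a quotient of two partial
    Pochhammer products, and the limit of the denominators is nonzero. *)
Lemma qGammaE (R : realType) (q x : R) : 0 < q < 1 -> 0 < x ->
  qGamma q x = (1 - q) `^ (1 - x) * (qPochhammer q q / qPochhammer (q `^ x) q).
Proof.
move=> q01 x_gt0; case/andP: (q01) => q_gt0 q_lt1.
have q01' : 0 <= q < 1 by rewrite ltW.
have qx01 : 0 <= q `^ x < 1.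
  by rewrite powR_ge0 powR_lt1.
have quotE : (fun N : nat =>
    \prod_(0 <= n < N) ((1 - q ^+ n.+1) / (1 - q `^ (n%:R + x)))) =
    (fun N => (\prod_(0 <= n < N) (1 - q * q ^+ n)) /
      (\prod_(0 <= n < N) (1 - q `^ x * q ^+ n))).
  apply/funext => N; rewrite -prodf_div; apply: eq_bigr => n _.
  rewrite exprS powRD ?powR_mulrn ?(ltW q_gt0) //.
    by rewrite (mulrC (q `^ x)).
  by rewrite (gt_eqF q_gt0) implybT.
rewrite /qGamma quotE; congr (_ * _); apply: cvg_lim => //.
apply: cvgM; first exact: is_cvg_qPochhammer.
apply: cvgV; first exact/lt0r_neq0/qPochhammer_gt0.
exact: is_cvg_qPochhammer.
Qed.

Theorem theorem2p6 (R : realType) (q : R) (hq0 : 0 < q) (hq1 : q < 1)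
    (x : R) (hx0 : 0 < x) (hx1 : x < 1) :
  1 / Num.sqrt (qpi q) < qGamma q (x + 1) / qGamma q (x + 2^-1) /\
  qGamma q (x + 1) / qGamma q (x + 2^-1)
    < (1 + Num.sqrt q) * (1 / Num.sqrt (qpi q)).
Proof.
have q01 : 0 < q < 1 by rewrite hq0.
have q_ge0 := ltW hq0.
set s := Num.sqrt q.
have s_gt0 : 0 < s by rewrite sqrtr_gt0.
have ss : s * s = q by rewrite -expr2 sqr_sqrtr.
have qs : 0 < q < s by nra.
have s_lt1 : s < 1 by nra.
have s01 : 0 <= s < 1 by rewrite ltW.
have q01' : 0 <= q < 1 by rewrite q_ge0.
have sq01 : 0 <= s * q < 1 by nra.
have qq01 : 0 <= q * q < 1 by nra.
have q_half : q `^ 2^-1 = s by exact: powR12_sqrt.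
pose u := q `^ x.
have u_gt0 : 0 < u by exact: powR_gt0.
have q_neq0 : q != 0 by rewrite gt_eqF.
have u_lt1 : u < 1 by exact: powR_lt1.
have q_lt_u : q < u.
  rewrite -[ltLHS](powRr1 q_ge0) -(subrK x 1) powRD ?q_neq0 ?implybT //.
  by rewrite gtr_pMl // powR_lt1 // subr_gt0.
have qx1 : q `^ (x + 1) = q * u.
  by rewrite powRD ?q_neq0 ?implybT // powRr1 // mulrC.
have qxh : q `^ (x + 2^-1) = s * u.
  by rewrite powRD ?q_neq0 ?implybT // q_half mulrC.
have su01 : 0 <= s * u < 1 by nra.
have qu01 : 0 <= q * u < 1 by nra.
have half_gt0 : 0 < 2^-1 :> R by rewrite invr_gt0.
have qs_gap : 0 < 1 - q by rewrite subr_gt0.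
have k_gt0 := powR_gt0 2^-1 qs_gap; set k := (1 - q) `^ 2^-1 in k_gt0.
have gamma_half : qGamma q 2^-1 = k * (qPochhammer q q / qPochhammer s q).
  rewrite qGammaE // q_half; congr (_ `^ _ * _); lra.
have sqrt_qpi : Num.sqrt (qpi q) = qGamma q 2^-1.
  rewrite /qpi sqrtr_sqr ger0_norm // gamma_half.
  by rewrite mulr_ge0 ?divr_ge0 // ltW ?qPochhammer_gt0.
have ratioE : qGamma q (x + 1) / qGamma q (x + 2^-1) =
    qPochhammer (s * u) q / (qPochhammer (q * u) q * k).
  rewrite !qGammaE ?addr_gt0 // qx1 qxh.
  (* The exponents of [1 - q] in the two Gamma values differ by one half, so their powers cancel up
     to [k]; the common product [qPochhammer q q] cancels as well. *)
  have -> : 1 - (x + 2^-1) = 1 - (x + 1) + 2^-1 by lra.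
  rewrite [in X in _ / X](powRD (r := 1 - (x + 1))) ?(gt_eqF qs_gap)
    ?implybT // -/k.
  have w_gt0 := powR_gt0 (1 - (x + 1)) qs_gap.
  by field; rewrite !gt_eqF ?qPochhammer_gt0.
have u1 : 0 <= u < 1 by rewrite ltW.
have uq : 0 <= q < u by rewrite q_ge0.
have s1 : s * 1 < 1 by rewrite mulr1.
have su1 : s * u < 1 by case/andP: su01.
(* Both bounds use [a = s] and [b = q]: first for the pair [u < 1], then for [q < u]. *)
have lower := lt_qPochhammer_cross q01 qs u1 s1.
have upper := lt_qPochhammer_cross q01 qs uq su1.
(* Splitting off the first factors of the products at [s] and [q] leaves
   [(1 - s) / (1 - q) = 1 / (1 + s)], which the constant [1 + s] cancels exactly. *)
have rightE : (1 + s) * (1 / (k * (qPochhammer q q / qPochhammer s q))) =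
    qPochhammer (s * q) q / (qPochhammer (q * q) q * k).
  rewrite (qPochhammerS q01 s01) (qPochhammerS q01 q01').
  have -> : 1 - q = (1 - s) * (1 + s) by rewrite -ss; ring.
  have s_gap : 0 < 1 - s by rewrite subr_gt0.
  have s1_gt0 : 0 < 1 + s by rewrite addr_gt0.
  by field; rewrite !gt_eqF ?qPochhammer_gt0.
rewrite sqrt_qpi gamma_half ratioE rightE; split.
  have -> : 1 / (k * (qPochhammer q q / qPochhammer s q)) =
      qPochhammer s q / (qPochhammer q q * k).
    by field; rewrite !gt_eqF ?qPochhammer_gt0.
  rewrite !mulr1 in lower.
  rewrite ltr_pdivrMr ?mulr_gt0 ?qPochhammer_gt0 // mulrAC.
  rewrite ltr_pdivlMr ?mulr_gt0 ?qPochhammer_gt0 //.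
  by rewrite !mulrA ltr_pM2r.
rewrite ltr_pdivrMr ?mulr_gt0 ?qPochhammer_gt0 // mulrAC.
rewrite ltr_pdivlMr ?mulr_gt0 ?qPochhammer_gt0 //.
by rewrite !mulrA ltr_pM2r.
Qed.
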